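(* Let $X$ be a finite-dimensional normed space, $Y$ a Banach space, $W$ a separable subspace of $\mathcal{L}(X,Y)$, $Q\subseteq X$ bounded, and $E\subseteq\operatorname{Int}(Q)$ an $F_\sigma$ purely unrectifiable set. Then for a typical $f\in(\operatorname{Lip}_1(Q,Y),\|\cdot\|_\infty)$ one has $\mathcal{D}_f(x)\supseteq\mathbb{B}_W$ for every $x\in E$; that is, the set of $f\in\operatorname{Lip}_1(Q,Y)$ such that $\mathcal{D}_f(x)\supseteq\mathbb{B}_W$ for every $x\in E$ is residual in $(\operatorname{Lip}_1(Q,Y),\|\cdot\|_\infty)$.
   Context: Normed spaces are real. $\mathcal{L}(X,Y)$ is the space of bounded linear operators $X\to Y$ with the operator norm; separability of $W$ refers to this norm, and $\mathbb{B}_W$ is the closed unit ball of $W$. $\operatorname{Int}Q$ is the interior of $Q$. $\operatorname{Lip}_1(Q,Y)$ is the set of mappings $f\colon Q\to Y$ that are Lipschitz with Lipschitz constant at most $1$, with the metric induced by $\|f\|_\infty=\sup_{x\in Q}\|f(x)\|_Y$. For $f\colon Q\to Y$ and $x\in\operatorname{Int}Q$, $$\mathcal{D}_f(x):=\Big\{T\in\mathcal{L}(X,Y)\colon \liminf_{r\to0+}\ \sup_{\|u\|_X\le r}\frac{\|f(x+u)-f(x)-Tu\|_Y}{r}=0\Big\}.$$ A set $E\subseteq X$ is purely unrectifiable if $\mathcal{H}^1(E\cap\gamma(\mathbb{R}))=0$ for every Lipschitz curve $\gamma\colon\mathbb{R}\to X$, where $\mathcal{H}^1$ is one-dimensional Hausdorff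 measure. $F_\sigma$ means a countable union of closed sets. A subset of a topological space is residual if its complement is of first Baire category. *)

(* Defs.v *)
From HB Require Import structures.
From mathcomp Require Export all_boot all_order all_algebra.
From mathcomp Require Export all_classical all_reals all_analysis.
From mathcomp Require Export borel_hierarchy.

Set Implicit Arguments.
Unset Strict Implicit.
Unset Printing Implicit Defensive.

Import Order.TTheory GRing.Theory Num.Theory.
Export numFieldNormedType.Exports.

Local Open Scope classical_set_scope.
Local Open Scope ring_scope.

#[short(type="finNormedModType")]
HB.structure Definition FinNormedModule (K : numDomainType) :=
  {V of NormedModule K V & Vector K V}.

Section Baire_category.
Context {T : topologicalType}.
Implicit Types A : set T.

Definition nowhere_dense A := (closure A)° = set0.

Definition meager A :=
  exists2 F : (set T)^nat, (forall n, nowhere_dense (F n)) & A = \bigcup_n F n.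

Definition residual A := meager (~` A).

End Baire_category.

Section Hausdorff_measure.
Context {R : realType} {X : normedModType R}.
Implicit Types A : set X.
Local Open Scope ereal_scope.

(* The maximum with 0 only matters for A = set0, where ereal_sup is -oo. *)
Definition diameter A : \bar R :=
  maxe 0 (ereal_sup [set `|p.1 - p.2|%:E | p in A `*` A]).

Definition hausdorff1_pre (d : R) A : \bar R :=
  ereal_inf [set \sum_(0 <= k <oo) diameter (F k) | F in
    [set F : (set X)^nat | (forall k, diameter (F k) <= d%:E) /\
                           A `<=` \bigcup_k F k]].

Definition hausdorff1 A : \bar R :=
  ereal_sup [set hausdorff1_pre d A | d in [set d | (0 < d)%R]].

Definition purely_unrectifiable A :=
  forall gamma : R -> X, lipschitz gamma -> hausdorff1 (A `&` range gamma) = 0.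

End Hausdorff_measure.

Section bounded_operators.
Context {R : realType} {X Y : normedModType R}.
Implicit Types (T : X -> Y) (W : set (X -> Y)).

Definition bounded_operators : set (X -> Y) :=
  [set T | linear T /\ exists M : R, forall x, `|T x| <= M * `|x|].

(* Only meaningful on bounded_operators, since sup is 0 on unbounded sets. *)
Definition opnorm T : R := sup [set `|T x| | x in [set x | `|x| <= 1]].

Definition operator_subspace W :=
  [/\ W `<=` bounded_operators, W 0 &
      forall (a : R) S T, W S -> W T -> W (a *: S + T)].

Definition opnorm_separable W :=
  exists D : set (X -> Y), [/\ countable D, D `<=` W &
    forall T, W T -> forall e : R, 0 < e -> exists2 S, D S & opnorm (T - S) < e].

Definition op_unit_ball W : set (X -> Y) := [set T | W T /\ opnorm T <= 1].

End bounded_operators.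

Section Lip1.
Context {R : realType} {X : normedModType R} (Y : normedModType R).
Context {Q : set X}.

Definition sup_norm (f : Q -> Y) : R := sup (range (fun x => `|f x|)).

(* Q being bounded makes the distances below finite; it is a parameter of the
   type so that the metric structure can be inferred from the type. *)
Definition lip1 (bQ : bounded_set Q) : Type :=
  [set f : Q -> Y | forall x y : Q, `|f x - f y| <= `|val x - val y|].

Context (bQ : bounded_set Q).
Implicit Types f g h : lip1 bQ.

HB.instance Definition _ := Choice.on (lip1 bQ).

Definition lip1_fun f : Q -> Y := set_val f.

Definition lip1_dist f g : R := sup_norm (fun x => lip1_fun f x - lip1_fun g x).

Lemma lip1P f (x y : Q) : `|lip1_fun f x - lip1_fun f y| <= `|val x - val y|.
Proof. exact: set_valP f x y. Qed.

Lemma lip1_dist_has_ubound f g :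
  has_ubound (range (fun x => `|lip1_fun f x - lip1_fun g x|)).
Proof.
have [[x0 _]|noQ] := pselect (exists x0 : Q, True); last first.
  by exists 0 => _ [x _ <-]; case: noQ; exists x.
have /pinfty_ex_gt0[M _ QM] := bQ.
exists (`|lip1_fun f x0 - lip1_fun g x0| + (M + M) + (M + M)) => _ [x _ <-].
have dx : `|val x - val x0| <= M + M.
  by rewrite (le_trans (ler_normB _ _))// lerD// QM//; apply: set_valP.
have -> : lip1_fun f x - lip1_fun g x =
    (lip1_fun f x0 - lip1_fun g x0) + (lip1_fun f x - lip1_fun f x0)
    - (lip1_fun g x - lip1_fun g x0).
  rewrite [X in _ = X + _]addrC addrA subrK opprB addrA.
  by rewrite -!addrA; congr (_ + _); rewrite addrA addNr add0r.
rewrite (le_trans (ler_normB _ _))// lerD ?(le_trans (lip1P _ _ _))//.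
by rewrite (le_trans (ler_normD _ _))// lerD2l (le_trans (lip1P _ _ _)).
Qed.

Lemma lip1_dist_ub f g (x : Q) : `|lip1_fun f x - lip1_fun g x| <= lip1_dist f g.
Proof. by apply: (ub_le_sup (lip1_dist_has_ubound f g)); exists x. Qed.

Lemma lip1_dist_le f g (e : R) : 0 <= e ->
  (forall x, `|lip1_fun f x - lip1_fun g x| <= e) -> lip1_dist f g <= e.
Proof.
move=> e0 fge; rewrite /lip1_dist /sup_norm.
have [->|/set0P ne] :=
  eqVneq (range (fun x => `|lip1_fun f x - lip1_fun g x|)) set0.
  by rewrite sup0.
by apply: ge_sup => // _ [x _ <-].
Qed.

Lemma lip1_dist_ge0 f g : 0 <= lip1_dist f g.
Proof.
rewrite /lip1_dist /sup_norm.
have [->|/set0P[_ [x _ _]]] :=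
  eqVneq (range (fun x => `|lip1_fun f x - lip1_fun g x|)) set0.
  by rewrite sup0.
exact: le_trans (lip1_dist_ub f g x).
Qed.

Let dist_xx f : lip1_dist f f = 0.
Proof.
apply/eqP; rewrite eq_le lip1_dist_ge0 andbT lip1_dist_le// => x.
by rewrite subrr normr0.
Qed.

Let dist_positivity f g : lip1_dist f g = 0 -> f = g.
Proof.
move=> fg0; apply: val_inj; apply/funext => x; apply/eqP.
by rewrite -subr_eq0 -normr_le0 -fg0; exact: lip1_dist_ub.
Qed.

Let dist_sym f g : lip1_dist f g = lip1_dist g f.
Proof.
by congr sup; apply: eq_imagel => x _; rewrite distrC.
Qed.

Let dist_triangle g f h : lip1_dist f h <= lip1_dist f g + lip1_dist g h.
Proof.
apply: lip1_dist_le => [|x]; first by rewrite addr_ge0 ?lip1_dist_ge0.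
rewrite (le_trans (ler_distD (lip1_fun g x) _ _))//.
by rewrite lerD ?lip1_dist_ub.
Qed.

HB.instance Definition _ := isMetric.Build R (lip1 bQ)
  dist_xx dist_positivity dist_sym dist_triangle.

End Lip1.

Section derivative_set.
Context {R : realType} {X Y : normedModType R} {Q : set X}.
Local Open Scope ereal_scope.

(* Here z ranges over the points x + u of Q with |u| <= r, so that u = z - x;
   when x is an interior point of Q and r is small, these are all the x + u. *)
Definition derivative_set (f : Q -> Y) (x : Q) : set (X -> Y) :=
  [set T | bounded_operators T /\
    limf_einf (fun r : R => ereal_sup
      [set (`|f z - f x - T (val z - val x)| / r)%:E | z in
        [set z : Q | (`|val z - val x| <= r)%R]]) 0^'+ = 0].

End derivative_set.

(* Main.v *)
Require Import Defs.
From HB Require Import structures.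
From mathcomp Require Import measurable_realfun.
From mathcomp Require Import ring lra.

(** Why the theorem holds.

    By separability of [W] and the Baire formalism, everything reduces to a
    density statement: given a compact purely unrectifiable [K] in the interior
    of [Q], a linear [T] of norm at most 1 and a 1-Lipschitz [f], find a
    1-Lipschitz [g], uniformly close to [f], which near [K] agrees with [T] up to
    a small relative error ([dense_almost_differentiable]). Such a [g] satisfies
    the required estimate with a margin at one small radius, hence so does
    everything in a ball around it.

    Convex combinations of the derivatives of [f] and [T] keep the norm at most
    1, so one wants to pass from [f] to [T] through them. No smoothing of [f] is
    needed: put g(x) = f(x - H x) + T (H x), divided by a constant close to 1,
    where [H] is a small displacement supported near [K] whose increments are,
    up to a small relative error, multiples t (x - y) of the increments of the
    identity with t in [0, 1], and with t = 1 near [K]. The increments of [g]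
    are then bounded by (1 - t) |x - y| + t |x - y|, up to the error
    ([almost_conformal_bump]).

    Changing t from 0 to 1 at once would be impossible for a small [H], but t may
    grow in [N] tiny steps, each of size 1/N and each carried out in a much
    smaller neighbourhood of [K] than the previous one ([partial_bump]). One
    step adds (1/N) chi G, where [chi] is a cutoff and [G] is a uniformly tiny
    Lipschitz map that is almost a translate of the identity near [K]. During the
    step the increments of [G] are only known to be bounded by C |x - y|, with
    [C] independent of everything, which costs an error of order C/N and no
    more.

    The map [G] is built coordinate by coordinate ([small_potential]), and here
    pure unrectifiability enters ([small_scalar_potential]). For a linear form
    [p] of norm at most 1, let [h x] be the least cost of a polygonal chain
    starting at [x], where a step from [y] to [z] costs |y - z| in general, but
    p (y - z) when both ends lie in a common tiny ball centred on [K], and in both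
    cases a further e |y - z|. Comparing the infima at [x] and [y] gives at once
    that [h] is Lipschitz and that it has increments p (x - y) up to e |x - y|
    near [K]. What remains is that [h] is small, that is, that no chain has a
    markedly negative cost.

    Lower bounds for costs come from calibrations ([calibrated_chain_cost_ge]):
    if [th] is a nondecreasing 1-Lipschitz function on the line that has slope 1
    at every value taken by [p] on the part of the chain near [K], the cost
    dominates the decrease of [th] o [p] along the chain. A truncation of the
    identity bounds all costs from below, so the extra e |y - z| takes care of
    long chains ([truncation_chain_cost_ge]). Chains of bounded length are
    treated by compactness ([short_chain_cost_ge]): were the claim false for all
    radii r = 1/(n + 1), the chains, parametrized by arc length, would converge
    pointwise along an ultrafilter to a Lipschitz curve. It meets [K] in an
    H1-null set, whose image under [p] lies in an open set [O] of small measure,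
    and u |-> |O `&` ]-oo, u]| is a calibration with small oscillation. *)

Set Implicit Arguments.
Unset Strict Implicit.
Unset Printing Implicit Defensive.

Import Order.TTheory GRing.Theory Num.Theory.
Import VectorInternalTheory.

Local Open Scope classical_set_scope.
Local Open Scope ring_scope.

(** * Finite-dimensional normed spaces *)

Section finite_dimension.
Context {R : realType} {X : finNormedModType R}.

Lemma r2v_le_norm : exists2 A : R, 0 < A &
  forall u : 'rV[R]_(dim X), `|r2v u : X| <= A * `|u|.
Proof.
exists (1 + \sum_i `|r2v (delta_mx 0 i) : X|) => [|u].
  by rewrite ltr_pwDl// sumr_ge0.
rewrite {1}(matrix_sum_delta u) big_ord1 linear_sum /=.
rewrite mulrDl mul1r mulr_suml (le_trans (ler_norm_sum _ _ _))//.
rewrite -[leLHS]add0r lerD// ler_sum// => i _.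
rewrite linearZ normrZ mulrC ler_wpM2l//.
rewrite [leRHS]/Num.norm/= mx_normrE.
by apply/bigmax_geP; right => /=; exists (0, i).
Qed.

(** [r2v] does not vanish on the unit sphere of the row vectors, which is
    compact, so its norm is bounded away from 0 there. *)
Lemma v2r_le_norm : exists2 C : R, 0 < C &
  forall x : X, `|v2r x| <= C * `|x|.
Proof.
have [A A0 rA] := r2v_le_norm.
pose S := [set u : 'rV[R]_(dim X) | `|u| = 1].
have cS : compact S.
  apply: bounded_closed_compact.
    by exists 1; split => // M M1 u /= ->; exact: ltW.
  rewrite (_ : S = Num.norm @^-1` [set 1]) //.
  by apply: closed_comp => [u _|]; [exact: norm_continuous|exact: closed_eq].
have cH : \forall c \near 0^'+, S `<=` (fun u => c <= `|r2v u : X|).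
  apply: (compact_near_coveringP S).1 => // u Su.
  have ru0 : 0 < `|r2v u : X|.
    rewrite normr_gt0; apply/eqP => ru0.
    have : u = 0 by apply: r2v_inj; rewrite ru0 linear0.
    by move=> u0; move: Su; rewrite /S/= u0 normr0 => /esym/eqP; rewrite oner_eq0.
  exists (ball u (`|r2v u : X| / 2 / A), [set c | c < `|r2v u : X| / 2]).
    split; first by apply: nbhsx_ballx; rewrite !divr_gt0.
    by apply: nbhs_right_lt; rewrite divr_gt0.
  move=> [u' c] /= [+ cl]; rewrite mx_norm_ball /ball_/= ltr_pdivlMr// mulrC => uu'.
  have : `|r2v u : X| <= `|r2v u' : X| + A * `|u - u'|.
    rewrite -{1}(subrK u' u) addrC linearD (le_trans (ler_normD _ _))// lerD2l.
    exact: rA.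
  lra.
have [c [c0 cS1]] : exists c : R, 0 < c /\ S `<=` (fun u => c <= `|r2v u : X|).
  near (0 : R)^'+ => c; exists c; split => //.
  by near: c.
exists c^-1; first by rewrite invr_gt0.
move=> x; have [->|x0] := eqVneq (v2r x) 0; first
  by rewrite normr0 mulr_ge0// invr_ge0 ltW.
have vx0 : 0 < `|v2r x| by rewrite normr_gt0.
have := cS1 (`|v2r x|^-1 *: v2r x).
rewrite /S/= normrZ normfV normr_id mulVf ?gt_eqF// => /(_ erefl).
rewrite linearZ/= v2rK normrZ normfV normr_id ler_pdivlMl//.
by rewrite ler_pdivlMl// mulrC.
Unshelve. all: by end_near. Qed.

(** [v2r] and [r2v] are mutually inverse Lipschitz maps, which reduces the claim
    to row vectors. *)
Lemma closed_bounded_compact (A : set X) :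
  bounded_set A -> closed A -> compact A.
Proof.
move=> bA cA.
have [B B0 rB] := r2v_le_norm; have [C C0 vC] := v2r_le_norm.
have cr : continuous (r2v : 'rV[R]_(dim X) -> X).
  move=> u; apply/(@cvgrPdist_lt _ X _ (nbhs u) (nbhs_filter u)) => e e0.
  have : nbhs u (ball u (B^-1 * e)) by
    apply: nbhsx_ballx; rewrite mulr_gt0// invr_gt0.
  apply: filterS => u'; rewrite mx_norm_ball /ball_/= => uu'.
  by rewrite -linearB (le_lt_trans (rB _))// -ltr_pdivlMl.
rewrite (_ : A = r2v @` (r2v @^-1` A)); last first.
  apply/seteqP; split => [x Ax|_ [u Au <-]]//.
  by exists (v2r x) => /=; rewrite v2rK.
apply: continuous_compact; first by apply: continuous_subspaceT.
apply: bounded_closed_compact.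
  have /pinfty_ex_gt0[M M0 AM] := bA.
  exists (C * M); split; first exact: num_real.
  move=> N MN u Au; apply: le_trans (ltW MN); rewrite -[u]r2vK.
  by rewrite (le_trans (vC _))// ler_pM2l//; exact: AM.
by apply: closed_comp => // u _; exact: cr.
Unshelve. all: by end_near. Qed.

End finite_dimension.

(** * Projections of sets of zero one-dimensional Hausdorff measure *)

Section null_sets.
Context {R : realType} {X : normedModType R}.

Lemma diameter_ge0 (A : set X) : (0 <= diameter A)%E.
Proof. by rewrite /diameter le_max lexx. Qed.

Lemma le_diameter (A : set X) x y : A x -> A y -> (`|x - y|%:E <= diameter A)%E.
Proof.
move=> Ax Ay; rewrite /diameter le_max; apply/orP; right.
by apply: ereal_sup_ubound; exists (x, y).
Qed.

Lemma hausdorff1_0_cover (A : set X) (d : R) : hausdorff1 A = 0%E -> 0 < d ->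
  exists D : nat -> R, exists F : (set X)^nat,
  [/\ forall k, 0 <= D k, forall k x y, F k x -> F k y -> `|x - y| <= D k,
   A `<=` \bigcup_k F k & (\sum_(k <oo) (D k)%:E <= d%:E)%E].
Proof.
move=> A0 d0.
have : (hausdorff1_pre 1 A < d%:E)%E.
  rewrite (@le_lt_trans _ _ 0%E)// -A0; apply: ereal_sup_ubound; exists 1 => //=.
move=> /ereal_inf_lt[_ [F [F1 AF] <-] Fd].
have Ffin k : diameter (F k) \is a fin_num.
  by rewrite ge0_fin_numE ?diameter_ge0// (le_lt_trans (F1 k))// ltry.
exists (fun k => fine (diameter (F k))), F; split => //.
- by move=> k; rewrite fine_ge0// diameter_ge0.
- by move=> k x y Fx Fy; rewrite -lee_fin fineK//; exact: le_diameter.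
- by rewrite (eq_eseriesr (fun k _ => fineK (Ffin k))) ltW.
Qed.

(** A set of diameter [D] is mapped by [p] into a ball of radius [D], hence into
    an open one of radius slightly larger; the enlargements form a geometric
    series. *)
Lemma hausdorff1_0_image (A : set X) (p : X -> R) (d : R) :
  (forall x y, `|p x - p y| <= `|x - y|) -> hausdorff1 A = 0%E -> 0 < d ->
  exists O : set R, [/\ open O, p @` A `<=` O & (lebesgue_measure O <= d%:E)%E].
Proof.
move=> p1 A0 d0.
have d40 : 0 < d / 4 by rewrite divr_gt0.
have [D [F [D0 FD AF SD]]] := hausdorff1_0_cover A0 d40.
pose r k := D k + d / 4 / (2 ^ k.+1)%:R.
have r0 k : 0 < r k by rewrite ltr_wpDl// divr_gt0// ltr0n expn_gt0.
(* [F k] may be empty: the centre is then irrelevant, since [r k] is positive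
   but summable in any case. *)
pose B k : set R := ball (p (xget 0 (F k))) (r k).
exists (\bigcup_k B k); split.
- by apply: bigcup_open => k _; exact: ball_open.
- move=> _ [x /AF[k _ Fx] <-]; exists k => //.
  rewrite /B /ball/= (le_lt_trans (p1 _ _))//.
  rewrite (@le_lt_trans _ _ (D k))//; last by
    rewrite ltrDl divr_gt0// ltr0n expn_gt0.
  by apply: FD => //; apply: xgetPex; exists x.
- have mB k : measurable (B k) by exact: measurable_ball.
  apply: (@le_trans _ _ (\sum_(k <oo) lebesgue_measure (B k))%E).
    apply: measure_sigma_subadditive => //.
    exact: bigcupT_measurable.
  rewrite (eq_eseriesr (g := fun k =>
      2%:E * ((D k)%:E + (d / 4 / (2 ^ k.+1)%:R)%:E))%E); last first.
    move=> k _; rewrite lebesgue_measure_ball ?(ltW (r0 k))//.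
    by rewrite -EFinD -EFinM mulr_natl.
  rewrite nneseriesZl; last first.
    by move=> k _; rewrite -EFinD lee_fin ltW// -/(r k).
  have := epsilon_trick xpredT (fun k => (D0 k : (0 <= (D k)%:E)%E)) (ltW d40).
  move=> /le_trans - /(_ ((d / 4)%:E + (d / 4)%:E)%E).
  rewrite leeD2r// => /(_ isT) H.
  rewrite (@le_trans _ _ (2%:E * ((d / 4)%:E + (d / 4)%:E))%E)// ?lee_pmul2l//.
  by rewrite -EFinD -EFinM lee_fin; lra.
Qed.

(** As in the calculus of variations: composed with a linear form, such a
    function bounds costs of paths from below by its oscillation. *)
Definition calibration (O : set R) (d : R) (th : R -> R) :=
  [/\ forall u, 0 <= th u <= d,
    forall u v, u <= v -> 0 <= th v - th u <= v - u &
    forall u v, u <= v -> (forall w, u <= w <= v -> O w) -> th v - th u = v - u].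

(** This is u |-> |O `&` ]-oo, u]|, a function which increases at unit speed
    inside [O] and by at most |O| altogether. *)
Lemma open_calibration (O : set R) (d : R) :
  open O -> (lebesgue_measure O <= d%:E)%E ->
  exists th, calibration O d th.
Proof.
move=> oO Od.
have mO : measurable O by exact: open_measurable.
pose mu := @lebesgue_measure R.
have mOI (i : interval R) : measurable (O `&` [set` i]) by exact: measurableI.
have muOI (i : interval R) : (mu (O `&` [set` i]) <= d%:E)%E.
  by apply: le_trans Od; apply: le_measure; rewrite ?inE//; exact: mOI.
have fOI (i : interval R) : mu (O `&` [set` i]) \is a fin_num.
  by rewrite ge0_fin_numE// (le_lt_trans (muOI i))// ltry.
pose th u := fine (mu (O `&` `]-oo, u])).
have thB u v : u <= v -> th v - th u = fine (mu (O `&` `]u, v])).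
  move=> uv; rewrite /th.
  have -> : O `&` `]-oo, v] = (O `&` `]-oo, u]) `|` (O `&` `]u, v]).
    rewrite -setIUr; congr (_ `&` _); apply/seteqP; split => w /=; rewrite !in_itv/=.
      by move=> wv; case: (leP w u) => wu; [left|right; rewrite wv].
    by move=> [wu|/andP[]//]; exact: le_trans uv.
  rewrite [mu _](measureU lebesgue_measure (mOI _) (mOI _)).
    by rewrite fineD ?fOI// addrAC subrr add0r.
  apply/seteqP; split => w //= -[[_ +] [_]]; rewrite !in_itv/= => wu /andP[uw _].
  by move: (le_lt_trans wu uw); rewrite ltxx.
have muI (u v : R) : u <= v -> mu [set` `]u, v]] = (v - u)%:E.
  move=> uv; rewrite /mu lebesgue_measure_itv/= lte_fin.
  case: ltP => // vu; have -> : u = v by apply/eqP; rewrite eq_le uv vu.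
  by rewrite subrr.
exists th; split.
- by move=> u; rewrite /th fine_ge0//= -lee_fin fineK.
- move=> u v uv; rewrite thB// fine_ge0//= -lee_fin fineK// -muI//.
  by apply: le_measure; rewrite ?inE//; exact: mOI.
- move=> u v uv Ouv; rewrite thB//.
  have -> : O `&` `]u, v] = [set` `]u, v]].
    apply/setIidPr => w /=; rewrite in_itv/= => /andP[uw wv].
    by apply: Ouv; rewrite wv ltW.
  by rewrite muI.
Qed.

End null_sets.

(** * Polygonal chains and their cost *)

Section chains.
Context {R : realType} {X : normedModType R}.
Implicit Types (x y : X) (s : seq X).

Fixpoint chain_length x s : R :=
  if s is y :: s' then `|y - x| + chain_length y s' else 0.

(** The polygonal line through [x :: s], parametrized by arc length. *)
Fixpoint chain_path x s (t : R) : X :=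
  if s is y :: s' then
    if t < `|y - x| then x + (t / `|y - x|) *: (y - x)
    else chain_path y s' (t - `|y - x|)
  else x.

Lemma chain_length_ge0 x s : 0 <= chain_length x s.
Proof. by elim: s x => //= y s IH x; rewrite addr_ge0. Qed.

Lemma chain_path0 x s : chain_path x s 0 = x.
Proof.
elim: s x => //= y s IH x; rewrite mul0r scale0r addr0 sub0r.
case: ltP => // yx0; have /eqP : `|y - x| = 0 by apply/eqP; rewrite eq_le yx0/=.
by rewrite normr_eq0 subr_eq0 => /eqP ->; rewrite subrr normr0 oppr0 IH.
Qed.

Lemma chain_path_lipschitz x s t1 t2 : 0 <= t1 <= t2 ->
  `|chain_path x s t1 - chain_path x s t2| <= t2 - t1.
Proof.
elim: s x t1 t2 => [|y s IH] x t1 t2 /= /andP[t10 t12].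
  by rewrite subrr normr0 subr_ge0.
set d := `|y - x|; have [t2d|dt2] := ltP t2 d.
  rewrite (le_lt_trans t12 t2d) opprD addrACA subrr add0r -scalerBl.
  have d0 : 0 < d by apply: le_lt_trans t2d; exact: le_trans t12.
  rewrite -mulrBl normrZ -/d normrM normfV [`|d|]gtr0_norm//.
  by rewrite divfK ?gt_eqF// distrC ger0_norm// subr_ge0.
have [t1d|dt1] := ltP t1 d; last first.
  by rewrite (le_trans (IH _ _ _ _))//; lra.
have d0 : 0 < d by exact: le_lt_trans t1d.
rewrite (le_trans (ler_distD y _ _))//.
have -> : x + (t1 / d) *: (y - x) - y = ((t1 - d) / d) *: (y - x).
  by rewrite mulrBl divff ?gt_eqF// scalerBl scale1r opprB addrCA addrA.
rewrite normrZ normrM normfV [`|d|]gtr0_norm// divfK ?gt_eqF//.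
rewrite ltr0_norm ?subr_lt0// -{1}(chain_path0 y s).
have := IH y 0 (t2 - d); rewrite lexx subr_ge0 => /(_ dt2); lra.
Qed.

(** Points of the first edge, parametrized proportionally so that the edge may
    also be degenerate. *)
Lemma chain_path_head x y s (a : R) : 0 <= a <= 1 ->
  chain_path x (y :: s) (a * `|y - x|) = x + a *: (y - x).
Proof.
move=> /andP[a0 a1] /=; have [yx|yx] := ltP (a * _) `|y - x|.
  have [d0|d0] := eqVneq `|y - x| 0.
    by move: yx; rewrite d0 mulr0 ltxx.
  by rewrite mulfK.
have [d0|d0] := eqVneq `|y - x| 0.
  rewrite d0 mulr0 subr0 chain_path0.
  move/eqP: d0; rewrite normr_eq0 subr_eq0 => /eqP ->.
  by rewrite subrr scaler0 addr0.
have -> : a = 1.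
  apply/eqP; rewrite eq_le a1 /= -(@ler_pM2r _ `|y - x|) ?mul1r//.
  by rewrite lt_neqAle eq_sym d0/=.
by rewrite mul1r subrr chain_path0 scale1r addrC subrK.
Qed.

Lemma chain_path_behead x y s t : 0 <= t ->
  chain_path x (y :: s) (t + `|y - x|) = chain_path y s t.
Proof. by move=> t0 /=; rewrite gtrDr ltNge t0/= addrK. Qed.

End chains.

Section cost.
Context {R : realType} {X : normedModType R}.
Variables (K : set X) (p : {scalar X}).
Hypothesis p1 : forall v, `|p v| <= `|v|.
Implicit Types (x y : X) (s : seq X) (r : R).

Definition close r x := exists2 q, K q & `|x - q| < r.

(** Balls being convex, an edge with jointly close ends stays close to [K]. *)
Definition jointly_close r x y := exists q, [/\ K q, `|x - q| < r & `|y - q| < r].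

(** The first branch can be negative. It rewards moving in the direction where
    [p] increases, but only next to [K]. *)
Definition step_cost r x y : R :=
  if `[< jointly_close r x y >] then p (x - y) else `|x - y|.

Fixpoint chain_cost r x s : R :=
  if s is y :: s' then step_cost r x y + chain_cost r y s' else 0.

(** Edge by edge: an edge of the second kind costs at least the decrease of [p],
    hence that of [th \o p] as [th] is 1-Lipschitz and nondecreasing. The same
    holds for an edge of the first kind along which [p] decreases. If [p]
    increases along it, from [u] to [v], the edge costs [u - v], and [th] has to
    increase as fast as possible; it does since every value in between is taken
    at a point of the edge, which is close to [K]. *)
Lemma calibrated_chain_cost_ge (O : set R) (d : R) (th : R -> R) r x s :
  calibration O d th ->
  (forall t, 0 <= t <= chain_length x s -> close r (chain_path x s t) ->
    O (p (chain_path x s t))) ->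
  th (p x) - th (p (last x s)) <= chain_cost r x s.
Proof.
move=> [th0 thL thO]; elim: s x => [|y s IH] x HO /=; first by rewrite subrr.
have {}IH : th (p y) - th (p (last y s)) <= chain_cost r y s.
  apply: IH => t /andP[t0 tl]; rewrite -(chain_path_behead x y)//.
  by apply: HO; rewrite /= addr_ge0//= addrC lerD2l.
suff : th (p x) - th (p y) <= step_cost r x y by lra.
rewrite /step_cost; case: asboolP => [[q [Kq xq yq]]|_]; last first.
  have := p1 (x - y); rewrite linearB/= ler_norml => /andP[pl pr].
  have [xy|/ltW yx] := leP (p x) (p y).
    by have := thL _ _ xy; have := normr_ge0 (x - y); lra.
  by have := thL _ _ yx; lra.
rewrite linearB/=; have [xy|/ltW yx] := leP (p x) (p y); last first.
  by have := thL _ _ yx; lra.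
rewrite -opprB thO// ?opprB// => w /andP[xw wy].
have [pxy|pxy] := eqVneq (p x) (p y).
  have -> : w = p x by apply/eqP; rewrite eq_le xw andbT pxy.
  rewrite -(chain_path0 x (y :: s)); apply: HO; rewrite ?lexx ?chain_length_ge0//.
  by rewrite chain_path0; exists q.
have pxy0 : 0 < p y - p x by rewrite subr_gt0 lt_neqAle pxy.
(* [x + a *: (y - x)] is the point of the edge where [p] takes the value [w]. *)
pose a := (w - p x) / (p y - p x).
have a01 : 0 <= a <= 1.
  by rewrite /a divr_ge0 ?ler_pdivrMr ?mul1r ?subr_ge0//= ?lerD2r// ltW.
have wE : w = p (chain_path x (y :: s) (a * `|y - x|)).
  rewrite chain_path_head// linearD linearZ/= linearB/= /a divfK ?gt_eqF//.
  by rewrite addrC subrK.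
rewrite {}wE; clearbody a; have /andP[a0 a1] := a01; apply: HO.
  rewrite mulr_ge0//= -[leLHS]addr0 lerD ?chain_length_ge0//.
  by rewrite ler_piMl.
rewrite chain_path_head//; exists q => //.
have -> : x + a *: (y - x) - q = (1 - a) *: (x - q) + a *: (y - q).
  rewrite scalerBl scale1r -[RHS]addrA [X in _ = _ + X]addrC -scalerBr.
  have -> : y - q - (x - q) = y - x by rewrite opprB addrA subrK.
  by rewrite addrAC.
rewrite (le_lt_trans (ler_normD _ _))// !normrZ !ger0_norm ?subr_ge0//.
have b0 : 0 <= 1 - a by rewrite subr_ge0.
have [a2|a2] := leP a (1 / 2); nra.
Qed.

Lemma chain_cost_ge (O : set R) (d : R) (th : R -> R) r x s :
  calibration O d th ->
  (forall t, 0 <= t <= chain_length x s -> close r (chain_path x s t) ->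
    O (p (chain_path x s t))) ->
  - d <= chain_cost r x s.
Proof.
move=> cth HO; have := calibrated_chain_cost_ge cth HO.
by case: cth => th0 _ _; have := th0 (p x); have := th0 (p (last x s)); lra.
Qed.

Lemma far_chain_cost_ge0 r x s :
  (forall t, 0 <= t <= chain_length x s -> ~ close r (chain_path x s t)) ->
  0 <= chain_cost r x s.
Proof.
move=> H; rewrite -oppr0; apply: (@chain_cost_ge set0 0 (fun=> 0)) => [|t /H//].
split => [u|u v uv|u v uv uv0]; rewrite ?subrr ?lexx ?subr_ge0//.
by case: (uv0 u); rewrite lexx.
Qed.

End cost.

(** * Chains near a purely unrectifiable compact set *)

(** Cluster points of an ultrafilter are limits. Applied at each time separately,
    this provides limits of sequences of curves. *)
Lemma compact_ultra_cvg {T : topologicalType} (I : Type) (U : set_system I)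
    (A : set T) (f : I -> T) : UltraFilter U -> compact A ->
  (\forall i \near U, A (f i)) -> exists x : T, f @ U --> x.
Proof.
move=> UU cA UA; have PU : ProperFilter U := ultra_proper.
have [x [Ax fx]] := cA (f @ U) _ UA; exists x => B Bx.
have [//|UB] := in_ultra_setVsetC (f @^-1` B) UU.
by have [y [By nBy]] := fx (~` B) B UB Bx.
Qed.

Section thin_neighbourhoods.
Context {R : realType} {X : finNormedModType R}.
Variables (K : set X) (p : {scalar X}).
Hypothesis p1 : forall v, `|p v| <= `|v|.
Hypotheses (cK : compact K) (puK : purely_unrectifiable K).

Lemma compact_le_norm : exists2 M : R, 0 < M & forall x, K x -> `|x| <= M.
Proof.
have /pinfty_ex_gt0[M M0 KM] := compact_bounded cK.
by exists M => // x /KM.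
Qed.

(** Suppose there are bad chains [c n] for the radii [r n = 1 / (n + 1)]. Their
    arc length parametrizations [g n] converge pointwise to a Lipschitz curve
    [g'] along an ultrafilter [U]. Let [O] be an open set of measure at most
    [eta] containing the image under [p] of the part of [g'] in [K]. By
    compactness of [[0, L]], for [U]-many [n] all points of [g n] that are close
    to [K] have their image under [p] in [O], and the calibration given by [O]
    contradicts the choice of [c n]. *)
Lemma short_chain_cost_ge (L eta : R) : 0 <= L -> 0 < eta ->
  exists2 r, 0 < r <= 1 &
  forall x s, chain_length x s <= L -> - eta <= chain_cost K p r x s.
Proof.
move=> L0 eta0; apply: contrapT => nr.
pose r n : R := n.+1%:R^-1.
have r01 n : 0 < r n <= 1 by rewrite invr_gt0 ltr0n/= invf_le1// ler1n.
have /choice[c c_bad] : forall n, exists c : X * seq X,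
    chain_length c.1 c.2 <= L /\ chain_cost K p (r n) c.1 c.2 < - eta.
  move=> n; apply: contrapT => nc; apply: nr; exists (r n) => // x s xsL.
  by rewrite leNgt; apply/negP => bad; apply: nc; exists (x, s).
pose g n t := chain_path (c n).1 (c n).2 (Num.max 0 t).
have gL n t1 t2 : `|g n t1 - g n t2| <= `|t1 - t2|.
  wlog t12 : t1 t2 / t1 <= t2.
    by move=> H; have [/H//|/ltW/H] := leP t1 t2; rewrite distrC [`|t2 - _|]distrC.
  rewrite (le_trans (chain_path_lipschitz _ _ _))//.
    by rewrite le_max lexx/= ge_max !le_max lexx/= t12 orbT.
  rewrite distrC ger0_norm ?subr_ge0//.
  by have [] := leP 0 t1; have [] := leP 0 t2; lra.
have [M M0 KM] := compact_le_norm.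
(* A bad chain has negative cost, so it comes close to [K] at some time. *)
have gM n t : `|g n t| <= M + 1 + (`|t| + L).
  have [t1 [/andP[t10 t1L] [q Kq gq]]] :
      exists t1, 0 <= t1 <= L /\ close K (r n) (g n t1).
    apply: contrapT => far; have [cL cB] := c_bad n.
    suff : 0 <= chain_cost K p (r n) (c n).1 (c n).2 by lra.
    apply: (far_chain_cost_ge0 p1) => t1 /andP[t10 t1c] ct1.
    apply: far; exists t1; rewrite t10 (le_trans t1c)//; split => //.
    by rewrite /g max_r.
  have := KM _ Kq; have := gL n t t1; have := ler_normB t t1.
  have := ler_norm t1; rewrite [`|t1|]ger0_norm// => _.
  have := ler_normD (g n t - g n t1) (g n t1); rewrite subrK.
  have := ler_normD (g n t1 - q) q; rewrite subrK.
  by have /andP[_] := r01 n; lra.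
have [U [UU U_oo]] := ultraFilterLemma (_ : ProperFilter (\oo : set_system nat)).
have PU : ProperFilter U := ultra_proper.
have /choice[g' gg'] : forall t, exists x : X, (g ^~ t) @ U --> x.
  move=> t.
  apply: (@compact_ultra_cvg _ _ _ [set x : X | `|x| <= M + 1 + (`|t| + L)]).
    apply: closed_bounded_compact.
      exists (M + 1 + (`|t| + L)); split; first exact: num_real.
      by move=> N /ltW N1 x /= /le_trans; exact.
    rewrite (_ : mkset _ =
      Num.norm @^-1` [set y : R | y <= M + 1 + (`|t| + L)])//.
    by apply: closed_comp => [x _|]; [exact: norm_continuous|exact: closed_le].
  by apply: nearW => n; exact: gM.
have gg'_near t e : 0 < e -> \forall n \near U, `|g' t - g n t| < e.
  by move=> e0; move/cvgrPdist_lt: (gg' t) => /(_ _ e0).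
have g'L : lipschitz g'.
  exists 1; split; first exact: num_real.
  move=> N /ltW N1 -[t1 t2] _ /=.
  rewrite (@le_trans _ _ `|t1 - t2|)//; last by rewrite ler_peMl.
  apply/ler_addgt0Pr => e e0; have e20 : 0 < e / 2 by rewrite divr_gt0.
  near U => n.
  have h1 : `|g' t1 - g n t1| < e / 2 by near: n; exact: gg'_near.
  have h2 : `|g' t2 - g n t2| < e / 2 by near: n; exact: gg'_near.
  have := ler_distD (g n t1) (g' t1) (g' t2).
  have := ler_distD (g n t2) (g n t1) (g' t2).
  by rewrite [`|g n t2 - _|]distrC; have := gL n t1 t2; lra.
have [|O [oO KO Oeta]] := hausdorff1_0_image _ (puK g'L) eta0 (p := p).
  by move=> x y; rewrite -linearB.
have [th cth] := open_calibration oO Oeta.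
have pL x y : `|p x - p y| <= `|x - y| by rewrite -linearB.
(* Near a time [t] with [g' t] in [K] the images are in [O], which is open, and
   near any other time the curves stay away from [K], which is closed. *)
have good : \forall n \near U, `[0, L] `<=`
    (fun t => close K (r n) (g n t) -> O (p (g n t))).
  apply: (compact_near_coveringP _).1 => [|t _]; first exact: segment_compact.
  have [Kt|nKt] := pselect (K (g' t)).
    have /nbhs_ballP[e /= e0 eO] : nbhs (p (g' t)) O.
      apply: open_nbhs_nbhs; split => //; apply: KO.
      by exists (g' t) => //; split => //; exists t.
    have e20 : 0 < e / 2 by rewrite divr_gt0.
    exists (ball t (e / 2), [set n | `|g' t - g n t| < e / 2]).
      by split; [exact: nbhsx_ballx|exact: gg'_near].
    move=> [t' n] /= [tt' gn] _; apply: eO; rewrite /ball/=.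
    rewrite /ball/= in tt'.
    rewrite (le_lt_trans (pL _ _))//.
    by have := ler_distD (g n t) (g' t) (g n t'); have := gL n t t'; lra.
  have /nbhs_ballP[e /= e0 eK] : nbhs (g' t) (~` K).
    apply: open_nbhs_nbhs; split => //.
    by apply: closed_openC; exact: compact_closed.
  have e30 : 0 < e / 3 by rewrite divr_gt0.
  exists (ball t (e / 3), [set n | `|g' t - g n t| < e / 3 /\ r n < e / 3]).
    split; first exact: nbhsx_ballx.
    apply: filterI; first exact: gg'_near.
    apply: U_oo; exact: (near_infty_natSinv_lt (PosNum e30)).
  move=> [t' n] /= [tt' [gn rn]] [q Kq gq]; exfalso; apply: (eK q) => //.
  rewrite -ball_normE/=; rewrite /ball/= in tt'.
  have := ler_distD (g n t) (g' t) q; have := ler_distD (g n t') (g n t) q.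
  by have := gL n t t'; lra.
near U => n.
have goodn : `[0, L] `<=` (fun t => close K (r n) (g n t) -> O (p (g n t))).
  by near: n; exact: good.
have [cL cB] := c_bad n.
suff : - eta <= chain_cost K p (r n) (c n).1 (c n).2 by lra.
apply: (chain_cost_ge p1 cth) => t /andP[t0 tc] ct.
have := goodn t; rewrite /g max_r//; apply => //.
by rewrite /= in_itv/= t0 (le_trans tc).
Unshelve. all: by end_near. Qed.

(** The points close to [K] form a bounded set, so that a truncation of the
    identity, with values in an interval of fixed length, is a calibration. *)
Lemma truncation_chain_cost_ge : exists M : R, 0 <= M /\
  forall r x s, r <= 1 -> - M <= chain_cost K p r x s.
Proof.
have [M M0 KM] := compact_le_norm.
pose N := M + 1; exists (N + N); split; first by rewrite /N; lra.
move=> r x s r1.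
pose th u := Num.min (Num.max (- N) u) N + N.
apply: (@chain_cost_ge _ _ K p p1 [set u | - N <= u <= N] (N + N) th).
  split => [u|u v uv|u v uv uvN]; rewrite /th.
  - by rewrite /Num.min /Num.max; do !case: ifPn; rewrite -?leNgt /N; lra.
  - by rewrite /Num.min /Num.max; do !case: ifPn; rewrite -?leNgt /N; lra.
  - have := uvN u; have := uvN v; rewrite !lexx uv /= => /(_ isT) vN /(_ isT).
    by move: vN; rewrite /Num.min /Num.max; do !case: ifPn; rewrite -?leNgt /N; lra.
move=> t _ [q Kq xq] /=; rewrite -ler_norml (le_trans (p1 _))//.
have := ler_normD (chain_path x s t - q) q; rewrite subrK.
by have := KM _ Kq; rewrite /N; lra.
Qed.

End thin_neighbourhoods.

(** * Small maps with prescribed derivative on a purely unrectifiable set *)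

Section small_potentials.
Context {R : realType} {X : finNormedModType R}.
Variables (K : set X).
Hypotheses (cK : compact K) (puK : purely_unrectifiable K).

(** [h x] is the infimum of the costs of the chains starting at [x], augmented by
    [e] times their length. Chains longer than [M / e] have nonnegative
    augmented cost if [- M] bounds all costs from below, and the shorter ones
    are controlled by the choice of [r]. *)
Lemma small_scalar_potential (p : {scalar X}) (e : R) :
  (forall v, `|p v| <= `|v|) -> 0 < e <= 1 ->
  exists h : X -> R, exists2 r, 0 < r &
  [/\ forall x, `|h x| <= e, forall x y, `|h x - h y| <= 2 * `|x - y| &
  forall q x y, K q -> `|x - q| < r -> `|y - q| < r ->
    `|h x - h y - p (x - y)| <= e * `|x - y|].
Proof.
move=> p1 /andP[e0 e1].
have [M [M0 longM]] := truncation_chain_cost_ge p1 cK.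
have [|r /andP[r0 r1] shortL] := short_chain_cost_ge p1 cK puK (L := M / e) _ e0.
  by rewrite divr_ge0// ltW.
pose cost x s := chain_cost K p r x s + e * chain_length x s.
have cost_ge x s : - e <= cost x s.
  have l0 := chain_length_ge0 x s; have el0 := mulr_ge0 (ltW e0) l0.
  have [/shortL|] := leP (chain_length x s) (M / e); first by rewrite /cost; lra.
  rewrite ltr_pdivrMr// mulrC => eM; have := longM _ x s r1.
  by rewrite /cost; lra.
pose h x := inf (range (cost x)).
have h_le x s : h x <= cost x s.
  by apply: ge_inf; [exists (- e) => _ [s' _ <-]|exists s].
have h_ge x (c : R) : (forall s, c <= cost x s) -> c <= h x.
  by move=> cx; apply: lb_le_inf; [exists (cost x [::]), [::]|move=> _ [s _ <-]].
have h_step x y : h x <= step_cost K p r x y + e * `|x - y| + h y.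
  rewrite -lerBlDl; apply: h_ge => s; rewrite lerBlDl.
  by rewrite (le_trans (h_le _ (y :: s)))// /cost/= distrC; lra.
exists h, r => //; split.
- move=> x; rewrite ler_norml h_ge//= (le_trans (h_le x [::]))// /cost/=; lra.
- have h1 x y : h x - h y <= 2 * `|x - y|.
    have : step_cost K p r x y <= `|x - y|.
      by rewrite /step_cost; case: asboolP => // _; rewrite (le_trans (ler_norm _)).
    have := h_step x y; have := normr_ge0 (x - y); nra.
  move=> x y; rewrite ler_norml h1 andbT; have := h1 y x; rewrite distrC; lra.
- move=> q x y Kq xq yq; have := h_step x y; have := h_step y x.
  rewrite /step_cost !asboolT; [|by exists q..].
  rewrite [`|y - x|]distrC -[y - x]opprB linearN ler_norml => h1 h2.
  by apply/andP; split; lra.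
Qed.

(** The coordinates of [G] are the functions of the previous lemma for the
    coordinate forms, scaled to norm at most 1. The constant [C] depends only on
    the space [X]: it must not depend on [e]. *)
Lemma small_potential : exists2 C : R, 0 < C & forall e : R, 0 < e ->
  exists G : X -> X, exists2 r, 0 < r &
  [/\ forall x, `|G x| <= e, forall x y, `|G x - G y| <= C * `|x - y| &
  forall q x y, K q -> `|x - q| < r -> `|y - q| < r ->
    `|G x - G y - (x - y)| <= e * `|x - y|].
Proof.
have [c c0 vc] := @v2r_le_norm R X.
pose b (i : 'I_(dim X)) : X := r2v (delta_mx 0 i).
pose B := 1 + \sum_i `|b i|.
have sB : \sum_i `|b i| <= B by rewrite lerDr.
have B0 : 0 < B by rewrite ltr_pwDl// sumr_ge0.
exists (2 * c * B) => [|e e0]; first by rewrite !mulr_gt0.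
pose e1 := Num.min 1 (e / (c * B)).
have e101 : 0 < e1 <= 1 by
  rewrite /e1 lt_min ltr01 divr_gt0 ?mulr_gt0//= ge_min lexx.
have e1e : c * e1 * B <= e.
  by rewrite mulrAC -ler_pdivlMl ?mulr_gt0// mulrC ge_min lexx orbT.
pose co (i : 'I_(dim X)) (x : X) : R := c^-1 * v2r x 0 i.
have coL i : linear (co i : X -> R^o).
  move=> a x y; rewrite /co linearP !mxE mulrDr; congr (_ + _).
  by rewrite /GRing.scale/= mulrCA.
pose coM i := GRing.isLinear.Build _ _ _ _ (co i) (coL i).
pose p i : {scalar X} := HB.pack (co i) (coM i).
have p1 i v : `|p i v| <= `|v|.
  rewrite /= /co normrM gtr0_norm ?invr_gt0// ler_pdivrMl//.
  rewrite (le_trans _ (vc v))// [leRHS]/Num.norm/= mx_normrE.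
  by apply/bigmax_geP; right => /=; exists (0, i).
have xE x : x = \sum_i (c * p i x) *: b i.
  rewrite -{1}[x]v2rK {1}(matrix_sum_delta (v2r x)) big_ord1 linear_sum/=.
  by apply: eq_bigr => i _; rewrite linearZ/= /co mulVKf// gt_eqF.
have /choice[h /choice[r hr]] : forall i, exists h : X -> R, exists r,
   0 < r /\ [/\ forall x, `|h x| <= e1, forall x y, `|h x - h y| <= 2 * `|x - y| &
  forall q x y, K q -> `|x - q| < r -> `|y - q| < r ->
    `|h x - h y - p i (x - y)| <= e1 * `|x - y|].
  by move=> i; have [h [r r0 hr]] := small_scalar_potential (p1 i) e101; exists h, r.
have sumb (a : 'I_(dim X) -> R) (d : R) : 0 <= d -> (forall i, `|a i| <= d) ->
    `|\sum_i (c * a i) *: b i| <= c * d * B.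
  move=> d0 ad; rewrite (le_trans (ler_norm_sum _ _ _))//.
  apply: (@le_trans _ _ (\sum_i c * d * `|b i|)).
    apply: ler_sum => i _; rewrite normrZ normrM (gtr0_norm c0) ler_wpM2r//.
    by rewrite ler_pM2l.
  by rewrite -mulr_sumr ler_wpM2l// mulr_ge0// ltW.
have /andP[e10 _] := e101.
exists (fun x => \sum_i (c * h i x) *: b i), (\big[Num.min/1]_i r i).
  by apply/bigmin_gtP; split => // i _; have [] := hr i.
split.
- by move=> x; rewrite (le_trans _ e1e)// sumb ?ltW// => i; have [_ []] := hr i.
- move=> x y; rewrite -sumrB.
  rewrite (eq_bigr (fun i => (c * (h i x - h i y)) *: b i)); last first.
    by move=> i _; rewrite mulrBr scalerBl.
  rewrite (le_trans (@sumb _ (2 * `|x - y|) _ _))//.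
    by move=> i; have [_ []] := hr i.
  by rewrite le_eqVlt; apply/orP; left; apply/eqP; ring.
- move=> q x y Kq xq yq.
  have -> : \sum_i (c * h i x) *: b i - \sum_i (c * h i y) *: b i - (x - y) =
      \sum_i (c * (h i x - h i y - p i (x - y))) *: b i.
    rewrite {1}(xE (x - y)) -!sumrB.
    by apply: eq_bigr => i _; rewrite [in RHS]mulrBr [in RHS]mulrBr !scalerBl.
  rewrite (le_trans (@sumb _ (e1 * `|x - y|) _ _))//.
  + by rewrite mulr_ge0// ltW.
  + move=> i; have [_ [_ _]] := hr i; apply => //.
    * exact: Kq.
    * by apply: lt_le_trans xq _; apply: bigmin_le_cond.
    * by apply: lt_le_trans yq _; apply: bigmin_le_cond.
  + by rewrite mulrA mulrAC ler_wpM2r.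
Qed.

End small_potentials.

(** * Small displacements with almost conformal increments *)

Section cutoff.
Context {R : realType} {X : normedModType R}.
Variable K : set X.

(** A truncation of [2 - 4 d / r], where [d] is the distance to [K]. *)
Lemma lipschitz_cutoff (r : R) : 0 < r -> exists chi : X -> R,
  [/\ forall x, 0 <= chi x <= 1, forall x y, `|chi x - chi y| <= 4 / r * `|x - y|,
    forall x q, K q -> `|x - q| < r / 4 -> chi x = 1 &
    forall x, ~ close K (r / 2) x -> chi x = 0].
Proof.
move=> r0; have [K0|/set0P[q0 Kq0]] := eqVneq K set0.
  exists (fun=> 0); split => //.
  - by move=> _; rewrite lexx ler01.
  - by move=> x y; rewrite subrr normr0 mulr_ge0// divr_ge0// ltW.
  - by move=> x q; rewrite K0.
pose D x := [set `|x - q| | q in K].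
pose d x := inf (D x).
have D0 x : lbound (D x) 0 by move=> _ [q _ <-].
have d_le x q : K q -> d x <= `|x - q|.
  by move=> Kq; apply: ge_inf; [exists 0; exact: D0|exists q].
have d_lip x y : d x <= d y + `|x - y|.
  rewrite -lerBlDr; apply: lb_le_inf; first by exists `|y - q0|, q0.
  move=> _ [q Kq <-]; have := d_le x _ Kq; have := ler_distD y x q; lra.
pose u x := 2 - 4 / r * d x.
have u_lip x y : u x - u y <= 4 / r * `|x - y|.
  have : 0 <= 4 / r by rewrite divr_ge0// ltW.
  by have := d_lip y x; rewrite distrC /u; nra.
exists (fun x => Num.max 0 (Num.min 1 (u x))); split.
- by move=> x; rewrite /Num.min /Num.max; do !case: ifPn; rewrite -?leNgt; lra.
- move=> x y; have := u_lip x y; have := u_lip y x; rewrite distrC.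
  have : 0 <= 4 / r * `|x - y| by rewrite mulr_ge0// divr_ge0// ltW.
  set a := u x; set b := u y; set c := _ * _ => c0 h1 h2; rewrite ler_norml.
  by rewrite /Num.min /Num.max; do !case: ifPn; rewrite -?leNgt; lra.
- move=> x q Kq xq; have : 1 <= u x.
    have : 4 / r * d x <= 1.
      rewrite mulrAC ler_pdivrMr// mul1r; have := d_le x _ Kq; lra.
    by rewrite /u; lra.
  by move=> u1; rewrite min_l// max_r.
- move=> x nx; have : u x <= 0.
    suff : 2 <= 4 / r * d x by rewrite /u; lra.
    rewrite mulrAC ler_pdivlMr//.
    suff : r / 2 <= d x by lra.
    apply: lb_le_inf; first by exists `|x - q0|, q0.
    by move=> _ [q Kq <-]; rewrite leNgt; apply/negP => xq; apply: nx; exists q.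
  by move=> u0; rewrite min_r ?max_l// (le_trans u0).
Qed.

End cutoff.

Section almost_conformal.
Context {R : realType} {X : finNormedModType R}.
Variables (K : set X).
Hypotheses (cK : compact K) (puK : purely_unrectifiable K).

Definition almost_homothety (H : X -> X) (t d : R) x y :=
  `|H x - H y - t *: (x - y)| <= d * `|x - y|.

(** Induction on [k]. The new map is [H + N^-1 chi G], where [H] is obtained for
    [k] and the error [d / 2], [chi] is a cutoff at a scale [rho] below the radius
    where [H] is known to be close to [k / N] times the identity, and [G] is a
    small potential, tiny relative to [rho]. For a given pair of points, either
    both are within [rho] of [K], the factor is [k / N] and the new summand,
    which is [(C + 1) / N]-Lipschitz, is part of the error; or the factor
    for [H] still works, because [chi] vanishes at both points or because they
    are so far apart that the new summand is negligible. *)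
Lemma partial_bump : exists2 C : R, 0 < C &
  forall N k : nat, (0 < N)%N -> (k <= N)%N -> forall e d : R, 0 < e -> 0 < d ->
  exists H : X -> X, exists2 r : R, 0 < r &
  [/\ forall x, `|H x| <= d,
    forall x, ~ close K e x -> H x = 0,
    forall x y, exists2 t : R, 0 <= t <= 1 &
      almost_homothety H t ((C + 1) / N%:R + d) x y &
    forall q x y, K q -> `|x - q| < r -> `|y - q| < r ->
      almost_homothety H (k%:R / N%:R) d x y].
Proof.
have [C C0 HG] := small_potential cK puK; exists C => // N k N0 kN e d e0.
have NR0 : 0 < N%:R :> R by rewrite ltr0n.
have N1 : N%:R^-1 <= 1 :> R by rewrite invf_le1// ler1n.
have Ni0 : 0 < N%:R^-1 :> R by rewrite invr_gt0.
set E := (C + 1) / N%:R.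
have E0 : 0 < E by rewrite divr_gt0// addr_gt0.
elim: k kN d => [|k IH] kN d d0.
  exists (fun=> 0), 1 => //; split => //.
  - by move=> x; rewrite normr0 ltW.
  - move=> x y; exists 0; rewrite ?lexx ?ler01//.
    by rewrite /almost_homothety scale0r !subr0 normr0 mulr_ge0// ltW// addr_gt0.
  - move=> q x y _ _ _.
    by rewrite /almost_homothety mul0r scale0r !subr0 normr0 mulr_ge0// ltW.
have d20 : 0 < d / 2 by rewrite divr_gt0.
have [H [r r0 [Hd He Ht Hk]]] := IH (ltnW kN) _ d20.
pose rho := Num.min r e.
have rho0 : 0 < rho by rewrite lt_min r0.
have rhor : rho <= r by rewrite ge_min lexx.
have rhoe : rho <= e by rewrite ge_min lexx orbT.
pose e1 := Num.min (d / 4) (Num.min (d * rho / 16) (rho / 4)).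
have e10 : 0 < e1 by rewrite !lt_min !divr_gt0// mulr_gt0.
have e1d : e1 <= d / 4 by rewrite ge_min lexx.
have e1dr : e1 <= d * rho / 16 by rewrite !ge_min lexx !orbT.
have e1r : e1 <= rho / 4 by rewrite !ge_min lexx !orbT.
have [G [s s0 [Ge GC Gs]]] := HG _ e10.
have [chi [chi01 chiL chi1 chi0]] := lipschitz_cutoff K rho0.
pose H' x := H x + N%:R^-1 *: (chi x *: G x).
have H'B x y : H' x - H' y = H x - H y + N%:R^-1 *: (chi x *: G x - chi y *: G y).
  by rewrite /H' opprD addrACA -scalerBr.
have cG x : `|chi x *: G x| <= e1.
  have /andP[c0 c1] := chi01 x; rewrite normrZ ger0_norm//.
  by rewrite (le_trans _ (Ge x))// ler_piMl.
have cGL x y : `|chi x *: G x - chi y *: G y| <= (C + 1) * `|x - y|.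
  have -> : chi x *: G x - chi y *: G y =
      chi x *: (G x - G y) + (chi x - chi y) *: G y.
    by rewrite scalerBr scalerBl addrA subrK.
  have /andP[c0 c1] := chi01 x.
  rewrite (le_trans (ler_normD _ _))// mulrDl mul1r lerD//.
    by rewrite normrZ ger0_norm// (le_trans _ (GC x y))// ler_piMl.
  rewrite normrZ (le_trans (ler_pM _ _ (chiL x y) (Ge y)))//.
  rewrite mulrAC -[leRHS]mul1r ler_wpM2r// mulrAC ler_pdivrMr// mul1r.
  by lra.
have bump t D x y : almost_homothety H t D x y ->
    `|H' x - H' y - t *: (x - y)| <=
      D * `|x - y| + N%:R^-1 * `|chi x *: G x - chi y *: G y|.
  move=> Htxy; rewrite H'B addrAC (le_trans (ler_normD _ _))// lerD//.
  by rewrite normrZ ger0_norm// ltW.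
exists H', (Num.min s rho / 4).
  by rewrite divr_gt0// lt_min s0.
split.
- move=> x; rewrite (le_trans (ler_normD _ _))// normrZ gtr0_norm//.
  have := Hd x; have := cG x.
  have : N%:R^-1 * `|chi x *: G x| <= `|chi x *: G x| by rewrite ler_piMl.
  lra.
- move=> x xe; rewrite /H' He// add0r chi0 ?scale0r ?scaler0//.
  by move=> [q Kq xq]; apply: xe; exists q => //; lra.
- move=> x y; have [t t01 Htxy] := Ht x y.
  have same : N%:R^-1 * `|chi x *: G x - chi y *: G y| <= d / 2 * `|x - y| ->
      exists2 t : R, 0 <= t <= 1 & almost_homothety H' t (E + d) x y.
    move=> small; exists t => //; rewrite /almost_homothety.
    by rewrite (le_trans (bump _ _ _ _ Htxy))//; move: small; lra.
  have [far|near] := leP (rho / 4) `|x - y|.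
    apply: same; rewrite (@le_trans _ _ (e1 + e1))//.
      rewrite (@le_trans _ _ `|chi x *: G x - chi y *: G y|) ?ler_piMl//.
      by rewrite (le_trans (ler_normB _ _))// lerD.
    rewrite (@le_trans _ _ (d / 2 * (rho / 4)))//; last by rewrite ler_pM2l.
    by lra.
  have mid q : K q -> `|x - q| < rho -> `|y - q| < rho ->
      exists2 t : R, 0 <= t <= 1 & almost_homothety H' t (E + d) x y.
    move=> Kq xq yq; exists (k%:R / N%:R).
      by rewrite divr_ge0//= ler_pdivrMr// mul1r ler_nat ltnW.
    have /bump := Hk _ _ _ Kq (lt_le_trans xq rhor) (lt_le_trans yq rhor).
    rewrite /almost_homothety => /le_trans; apply.
    have : N%:R^-1 * `|chi x *: G x - chi y *: G y| <= E * `|x - y|.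
      by rewrite /E mulrAC mulrC ler_pM2r.
    have : 0 <= d * `|x - y| by rewrite mulr_ge0// ltW.
    by lra.
  have [[q Kq xq]|nx] := pselect (close K (rho / 2) x).
    apply: (mid q) => //; first lra.
    by have := ler_distD x y q; rewrite [`|y - x|]distrC; lra.
  have [[q Kq yq]|ny] := pselect (close K (rho / 2) y).
    apply: (mid q) => //; last lra.
    by have := ler_distD y x q; lra.
  apply: same; rewrite !chi0// !scale0r subrr normr0 mulr0 mulr_ge0//.
  by rewrite ltW.
- move=> q x y Kq xs ys.
  have sle : Num.min s rho <= s by rewrite ge_min lexx.
  have srho : Num.min s rho <= rho by rewrite ge_min lexx orbT.
  have xs1 : `|x - q| < s by lra.
  have ys1 : `|y - q| < s by lra.
  have xr1 : `|x - q| < r by lra.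
  have yr1 : `|y - q| < r by lra.
  have Hxy := Hk _ _ _ Kq xr1 yr1.
  have Gxy := Gs _ _ _ Kq xs1 ys1.
  rewrite /almost_homothety H'B !(chi1 _ _ Kq); [|lra..].
  rewrite !scale1r -natr1 mulrDl scalerDl mul1r opprD addrACA -scalerBr.
  rewrite (le_trans (ler_normD _ _))// normrZ gtr0_norm//.
  have : N%:R^-1 * `|G x - G y - (x - y)| <= `|G x - G y - (x - y)|
    by rewrite ler_piMl.
  have : e1 * `|x - y| <= d / 2 * `|x - y| by rewrite ler_wpM2r//; lra.
  move: Hxy; rewrite /almost_homothety.
  lra.
Qed.

(** The case [k = N] of the previous lemma, with [N] large. *)
Lemma almost_conformal_bump (e : R) : 0 < e ->
  exists H : X -> X, exists2 r : R, 0 < r &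
  [/\ forall x, `|H x| <= e,
    forall x, ~ close K e x -> H x = 0,
    forall x y, exists2 t : R, 0 <= t <= 1 & almost_homothety H t e x y &
    forall q x y, K q -> `|x - q| < r -> `|y - q| < r -> almost_homothety H 1 e x y].
Proof.
move=> e0; have [C C0 bump] := partial_bump.
have e20 : 0 < e / 2 by rewrite divr_gt0.
have [N CN] : exists N, (C + 1) / N.+1%:R < e / 2.
  have : 0 < e / 2 / (C + 1) by rewrite divr_gt0// addr_gt0.
  move=> /ltr_add_invr[N]; rewrite add0r => N1; exists N.
  by rewrite mulrC -ltr_pdivlMr// addr_gt0.
have CNe : (C + 1) / N.+1%:R + e / 2 <= e by rewrite [leRHS]splitr lerD2r ltW.
have [H [r r0 [Hd He Ht Hk]]] := bump _ _ (ltn0Sn N) (leqnn N.+1) _ _ e0 e20.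
exists H, r => //; split => //.
- by move=> x; rewrite (le_trans (Hd x))//; lra.
- move=> x y; have [t t01 Htxy] := Ht x y; exists t => //.
  by rewrite /almost_homothety (le_trans Htxy)// ler_wpM2r.
- move=> q x y Kq xq yq; have := Hk q x y Kq xq yq; rewrite divff ?pnatr_eq0//.
  by rewrite /almost_homothety => /le_trans; apply; rewrite ler_wpM2r//; lra.
Qed.

End almost_conformal.

(** * Density of almost differentiable mappings *)

Section operator_norm.
Context {R : realType} {X Y : normedModType R}.

Lemma bounded_operatorsP (T : X -> Y) : bounded_operators T ->
  exists2 L : {linear X -> Y}, T = L & exists M : R, forall x, `|L x| <= M * `|x|.
Proof.
move=> [lT TM].
pose L : {linear X -> Y} := HB.pack T (GRing.isLinear.Build _ _ _ _ T lT).
by exists L.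
Qed.

Lemma le_opnorm (T : X -> Y) x : bounded_operators T -> `|T x| <= opnorm T * `|x|.
Proof.
move=> /bounded_operatorsP[{}T -> [M TM]].
have [->|x0] := eqVneq x 0.
  by rewrite linear0 !normr0 mulr0.
have nx0 : 0 < `|x| by rewrite normr_gt0.
rewrite -ler_pdivrMr//; apply: ub_le_sup.
  exists `|M| => _ [u /= u1 <-]; rewrite (le_trans (TM u))//.
  rewrite (le_trans (ler_wpM2r _ (ler_norm M)))//.
  by rewrite ler_piMr.
exists (`|x|^-1 *: x) => /=.
  by rewrite normrZ normfV normr_id mulVf ?gt_eqF.
by rewrite linearZ normrZ normfV normr_id mulrC.
Qed.

Lemma opnorm_le (T : X -> Y) (c : R) : 0 <= c ->
  (forall x, `|T x| <= c * `|x|) -> opnorm T <= c.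
Proof.
move=> c0 Tc; apply: ge_sup; first by exists `|T 0|, 0 => //=; rewrite normr0.
by move=> _ [x /= x1 <-]; rewrite (le_trans (Tc x))// ler_piMr.
Qed.

End operator_norm.

Section density.
Context {R : realType} {X : finNormedModType R} {Y : normedModType R}.
Variables (Q : set X) (bQ : bounded_set Q).
Implicit Types f g : lip1 Y bQ.

Lemma compact_in_interior (K : set X) : compact K -> K `<=` Q° ->
  exists2 r : R, 0 < r & forall q x, K q -> `|x - q| < r -> Q x.
Proof.
move=> cK KQ.
have nr : \forall r \near 0^'+, K `<=` (fun q => forall x, `|x - q| < r -> Q x).
  apply: (compact_near_coveringP K).1 => // q /KQ /nbhs_ballP[e /= e0 eQ].
  have e20 : 0 < e / 2 by rewrite divr_gt0.
  exists (ball q (e / 2), [set r | r < e / 2]).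
    by split; [exact: nbhsx_ballx|exact: nbhs_right_lt].
  move=> [q' r] /=; rewrite -ball_normE/= => -[qq' re] x xq'; apply: eQ.
  rewrite -ball_normE/= distrC.
  by have := ler_distD q' x q; rewrite [`|q' - q|]distrC; lra.
have [r [r0 Hr]] : exists r : R, 0 < r /\
    K `<=` (fun q => forall x, `|x - q| < r -> Q x).
  by near (0 : R)^'+ => r; exists r; split => //; near: r; exact: nr.
by exists r => // q x Kq; exact: Hr.
Unshelve. all: by end_near. Qed.

Lemma lip1_bounded f : exists2 B : R, 0 <= B & forall x : Q, `|lip1_fun f x| <= B.
Proof.
have [[x0 _]|noQ] := pselect (exists x0 : Q, True); last first.
  by exists 0 => // x; case: noQ; exists x.
have /pinfty_ex_gt0[M M0 QM] := bQ.
exists (`|lip1_fun f x0| + (M + M)); first by rewrite !addr_ge0// ltW.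
move=> x; rewrite -[lip1_fun f x](subrK (lip1_fun f x0)) addrC.
rewrite (le_trans (ler_normD _ _))// lerD2l (le_trans (lip1P _ _ _))//.
by rewrite (le_trans (ler_normB _ _))// lerD// QM//; exact: set_valP.
Qed.

(** The witness is g(x) = (f(x - H x) + T (H x)) / (1 + 2 e1), with [H] the bump
    for a small [e1]. Since [H] is small and supported near [K], the points
    [x - H x] remain in [Q], which need not be convex. *)
Lemma dense_almost_differentiable (K : set X) (T : {linear X -> Y}) f (e : R) :
  compact K -> purely_unrectifiable K -> K `<=` Q° ->
  (forall v, `|T v| <= `|v|) -> 0 < e ->
  exists g, exists2 r : R, 0 < r & lip1_dist f g < e /\
    forall x z : Q, K (val x) -> `|val z - val x| < r ->
      `|lip1_fun g z - lip1_fun g x - T (val z - val x)| <= e * `|val z - val x|.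
Proof.
move=> cK puK KQ T1 e0.
have [rho rho0 rhoQ] := compact_in_interior cK KQ.
have [B B0 fB] := lip1_bounded f.
have B8 : 0 < 8 * (B + 3) by lra.
(* The distance from [f] to [g] is at most [2 e1 + 2 e1 (B + 2 e1)], and the
   relative error near [K] is at most [4 e1]. *)
pose e1 := Num.min 1 (Num.min (rho / 2) (e / (8 * (B + 3)))).
have e10 : 0 < e1 by rewrite !lt_min ltr01 !divr_gt0.
have e11 : e1 <= 1 by rewrite ge_min lexx.
have e1rho : e1 <= rho / 2 by rewrite !ge_min lexx !orbT.
have e1e : e1 * (8 * (B + 3)) <= e by rewrite -ler_pdivlMr// !ge_min lexx !orbT.
have e1B : 0 <= e1 * B by rewrite mulr_ge0// ltW.
have [H [r r0 [H1 H2 H3 H4]]] := almost_conformal_bump cK puK e10.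
have HQ x : Q x -> Q (x - H x).
  move=> Qx; have [[q Kq xq]|nx] := pselect (close K e1 x); last first.
    by rewrite H2// subr0.
  apply: (rhoQ q) => //; rewrite addrAC (le_lt_trans (ler_normB _ _))//.
  by have := H1 x; lra.
pose F (x : X) : Y :=
  if pselect (Q x) is left Qx then lip1_fun f (SigSub (mem_set Qx)) else 0.
have FE (z : Q) : F (val z) = lip1_fun f z.
  rewrite /F; case: pselect => [Qz|]; last by case; exact: set_valP.
  by congr lip1_fun; exact: val_inj.
have F1 x y : Q x -> Q y -> `|F x - F y| <= `|x - y|.
  by rewrite /F; do 2![case: pselect => // ?] => _ _; exact: lip1P.
pose g0 x := F (x - H x) + T (H x).
have g0B x y : Q x -> Q y ->
    `|g0 x - g0 y| <= `|(x - y) - (H x - H y)| + `|H x - H y|.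
  move=> Qx Qy; rewrite /g0 opprD addrACA -linearB.
  rewrite (le_trans (ler_normD _ _))// lerD//.
  rewrite (le_trans (F1 _ _ (HQ _ Qx) (HQ _ Qy)))//.
  by rewrite [in X in X <= _]opprD addrACA -opprD.
have g0L x y : Q x -> Q y -> `|g0 x - g0 y| <= (1 + 2 * e1) * `|x - y|.
  move=> Qx Qy; rewrite (le_trans (g0B _ _ Qx Qy))//.
  have [t /andP[t0 t1]] := H3 x y; rewrite /almost_homothety.
  move: (x - y) (H x - H y) => v w wv.
  have : `|v - w| <= (1 - t) * `|v| + `|w - t *: v|.
    rewrite -{1}[1 - t]ger0_norm ?subr_ge0// -normrZ.
    have -> : v - w = (1 - t) *: v - (w - t *: v).
      by rewrite scalerBl scale1r opprB addrA subrK.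
    exact: ler_normB.
  have : `|w| <= `|w - t *: v| + t * `|v|.
    by rewrite -{2}[t]ger0_norm// -normrZ -{1}(subrK (t *: v) w) ler_normD.
  lra.
pose c := (1 + 2 * e1)^-1.
have c0 : 0 < c by rewrite invr_gt0; lra.
have cE : c * (1 + 2 * e1) = 1 by rewrite mulVf//; lra.
have c1 : 0 <= 1 - c <= 2 * e1 by nra.
have /andP[c1l c1r] := c1.
pose g1 (z : Q) := c *: g0 (val z).
have g1L : [set h : Q -> Y | forall x y : Q, `|h x - h y| <= `|val x - val y|] g1.
  move=> x y; rewrite /g1 -scalerBr normrZ gtr0_norm//.
  rewrite -[leRHS]mul1r -cE -mulrA ler_pM2l//.
  by apply: g0L; exact: set_valP.
pose g : lip1 Y bQ := SigSub (mem_set g1L).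
have gE z : lip1_fun g z = c *: g0 (val z) by [].
have g0f (z : Q) : `|lip1_fun f z - g0 (val z)| <= 2 * e1.
  have Qz : Q (val z) := set_valP z.
  rewrite -FE /g0 opprD addrA (le_trans (ler_normB _ _))//.
  have := F1 _ _ Qz (HQ _ Qz); rewrite opprB addrCA subrr addr0.
  have := T1 (H (val z)); have := H1 (val z); lra.
exists g, r => //; split.
  apply: (@le_lt_trans _ _ (2 * e1 + 2 * e1 * (B + 2 * e1))); last nra.
  apply: lip1_dist_le; first by nra.
  move=> z; rewrite gE.
  have -> : lip1_fun f z - c *: g0 (val z) =
      (lip1_fun f z - g0 (val z)) + (1 - c) *: g0 (val z).
    by rewrite scalerBl scale1r addrA subrK.
  rewrite (le_trans (ler_normD _ _))// lerD// normrZ ger0_norm//.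
  apply: ler_pM => //.
  have := ler_normB (lip1_fun f z) (lip1_fun f z - g0 (val z)).
  by rewrite opprB addrCA subrr addr0; have := fB z; have := g0f z; lra.
move=> x z Kx xz; rewrite !gE; set v := val z - val x.
have zz : `|val z - val x| < r by [].
have Hv := H4 _ _ _ Kx zz (_ : `|val x - val x| < r); rewrite subrr normr0 in Hv.
have {}Hv := Hv r0; rewrite /almost_homothety scale1r -/v in Hv.
have -> : c *: g0 (val z) - c *: g0 (val x) - T v =
    c *: (g0 (val z) - g0 (val x) - T v) - (1 - c) *: T v.
  by rewrite scalerBl scale1r !scalerBr opprB addrA subrK.
rewrite (le_trans (ler_normB _ _))// !normrZ gtr0_norm// [`|1 - c|]ger0_norm//.
have Qz : Q (val z) := set_valP z; have Qx : Q (val x) := set_valP x.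
have : `|g0 (val z) - g0 (val x) - T v| <= 2 * (e1 * `|v|).
  have -> : g0 (val z) - g0 (val x) - T v =
      (F (val z - H (val z)) - F (val x - H (val x)))
      + T (H (val z) - H (val x) - v).
    rewrite (raddfB T (_ - _) v) (raddfB T (H _) (H _)) /g0.
    by rewrite [in LHS]opprD [in LHS]addrACA [in RHS]addrA.
  rewrite (le_trans (ler_normD _ _))// mulr_natl mulr2n lerD//.
    rewrite (le_trans (F1 _ _ (HQ _ Qz) (HQ _ Qx)))// (le_trans _ Hv)//.
    rewrite -[leLHS]normrN.
    by rewrite [in X in - X](opprD (val x)) addrACA -opprD opprB.
  by rewrite (le_trans (T1 _)).
have v0 := normr_ge0 v; have e1v : 0 <= e1 * `|v| by rewrite mulr_ge0// ltW.
have := T1 v; set a := `|g0 _ - _ - _|; set b := `|T v| => bv av.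
have a0 : 0 <= a := normr_ge0 _; have b0 : 0 <= b := normr_ge0 _.
have : c * a <= a by rewrite ler_piMl//; lra.
have : (1 - c) * b <= 2 * e1 * `|v| by apply: ler_pM.
have : 4 * (e1 * `|v|) <= e * `|v|.
  by rewrite mulrA ler_wpM2r//; lra.
lra.
Qed.

End density.

(** * Typical mappings *)

Lemma purely_unrectifiableS {R : realType} {X : normedModType R} (A B : set X) :
  A `<=` B -> purely_unrectifiable B -> purely_unrectifiable A.
Proof.
move=> AB puB g /puB B0; apply/eqP; rewrite eq_le; apply/andP; split.
  rewrite -B0; apply: ge_ereal_sup => _ [d /= d0 <-].
  apply: (@le_trans _ _ (hausdorff1_pre d (B `&` range g))); last first.
    by apply: ereal_sup_ubound; exists d.
  apply: ereal_inf_le_tmp => _ [F [Fd BF] <-]; exists F => //; split => //.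
  by apply: subset_trans BF; apply: setSI.
apply: (@le_trans _ _ (hausdorff1_pre 1 (A `&` range g))); last first.
  by apply: ereal_sup_ubound; exists 1 => /=.
apply: le_ereal_inf_tmp => _ [F _ <-]; apply: nneseries_ge0 => k _ _.
exact: diameter_ge0.
Qed.

Lemma nowhere_denseS {T : topologicalType} (A B : set T) :
  A `<=` B -> nowhere_dense B -> nowhere_dense A.
Proof.
rewrite /nowhere_dense => AB B0; apply/seteqP; split => //.
by rewrite -B0; apply: interiorS; exact: closureS.
Qed.

Section operator_space.
Context {R : realType} {X Y : normedModType R} (W : set (X -> Y)).
Hypotheses (subW : operator_subspace W) (sepW : opnorm_separable W).

(** A dense sequence of [W], divided by the maximum of 1 and the norm: this moves
    the elements that are close to the unit ball only a little. *)
Lemma separable_op_unit_ball : exists S : nat -> {linear X -> Y},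
  (forall j v, `|S j v| <= `|v|) /\
  forall T, op_unit_ball W T -> forall e : R, 0 < e ->
    exists j, forall v, `|T v - S j v| <= e * `|v|.
Proof.
have [Wb W0 WZD] := subW; have [D [/countable_injP[f finj] DW Dd]] := sepW.
have WB T S : W T -> W S -> W (T - S).
  move=> WT WS; have -> : T - S = (-1) *: S + T by rewrite scaleN1r addrC.
  exact: WZD.
pose S0 j : X -> Y := xget 0 [set S | D S /\ f S = j].
have WS0 j : W (S0 j).
  by rewrite /S0; case: xgetP => [S _ [/DW]|]//.
have S0f S : D S -> S0 (f S) = S.
  move=> DS; rewrite /S0; case: xgetP => [S' _ [DS' fS']|/(_ S)[]//].
  by apply: finj => //; rewrite inE.
pose mu T : R := Num.max 1 (opnorm (T : X -> Y)).
have mu1 T : 1 <= mu T by rewrite le_max lexx.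
have mu0 T : 0 < mu T by exact: lt_le_trans (mu1 T).
have muT T : opnorm T <= mu T by rewrite le_max lexx orbT.
have /choice[S SE] : forall j, exists L : {linear X -> Y},
    forall v, L v = (mu (S0 j))^-1 *: S0 j v.
  move=> j; have WS := WZD (mu (S0 j))^-1 _ _ (WS0 j) W0.
  have [L LE _] := bounded_operatorsP (Wb _ WS).
  by exists L => v; rewrite -LE fctE addr0.
exists S; split=> [j v|T [WT T1] e e0].
  rewrite SE normrZ gtr0_norm ?invr_gt0// ler_pdivrMl//.
  by rewrite (le_trans (le_opnorm _ (Wb _ (WS0 j))))// ler_wpM2r.
have [U DU TU] := Dd T WT (e / 2) (divr_gt0 e0 (ltr0Sn _ 1)).
exists (f U) => v; rewrite SE S0f//.
have WU := DW _ DU.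
have TUv w : `|T w - U w| <= e / 2 * `|w|.
  rewrite (le_trans (le_opnorm w (Wb _ (WB _ _ WT WU))))//.
  by rewrite ler_wpM2r// ltW.
have U1 : opnorm U <= 1 + e / 2.
  apply: opnorm_le => [|w]; first by rewrite addr_ge0// divr_ge0// ltW.
  rewrite mulrDl mul1r.
  have : `|T w| <= `|w|.
    by rewrite (le_trans (le_opnorm w (Wb _ WT)))// ler_piMl.
  have := ler_normB (T w) (T w - U w); rewrite opprB addrCA subrr addr0.
  by have := TUv w; lra.
have m1 : mu U <= 1 + e / 2 by rewrite /mu ge_max U1 lerDl divr_ge0// ltW.
have -> : T v - (mu U)^-1 *: U v = (T v - U v) + (1 - (mu U)^-1) *: U v.
  by rewrite scalerBl scale1r addrA subrK.
rewrite (le_trans (ler_normD _ _))// [e]splitr mulrDl lerD//.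
have mui : (mu U)^-1 <= 1 by rewrite invf_le1.
rewrite normrZ ger0_norm ?subr_ge0//.
apply: (@le_trans _ _ ((1 - (mu U)^-1) * (mu U * `|v|))).
  rewrite ler_wpM2l ?subr_ge0// (le_trans (le_opnorm v (Wb _ WU)))//.
  by rewrite ler_wpM2r.
by rewrite mulrA mulrBl mul1r mulVf ?gt_eqF// ler_wpM2r//; lra.
Qed.

End operator_space.

Section typical.
Context {R : realType} {X : finNormedModType R} {Y : normedModType R}.
Variables (Q : set X) (bQ : bounded_set Q).

(** The radius is common to all points of [K]: the condition then survives
    uniform perturbations that are small relative to this one radius. *)
Definition almost_differentiable (K : set X) (T : X -> Y) (m : nat) :
    set (lip1 Y bQ) :=
  [set f | exists r : R, 0 < r < m.+1%:R^-1 /\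
    forall x z : Q, K (val x) -> `|val z - val x| <= r ->
      `|lip1_fun f z - lip1_fun f x - T (val z - val x)| <= r / m.+1%:R].

(** Near any [f] there is a [g] that satisfies the estimate at a radius [r] with
    constant [1 / 2] instead of 1; so does every [h] at distance less than
    [r / (4 (m + 1))] from [g], with constant 1. *)
Lemma nowhere_dense_not_almost_differentiable (K : set X) (T : {linear X -> Y}) m :
  compact K -> purely_unrectifiable K -> K `<=` Q° ->
  (forall v, `|T v| <= `|v|) -> nowhere_dense (~` almost_differentiable K T m).
Proof.
move=> cK puK KQ T1; rewrite /nowhere_dense -subset0 => f /nbhs_ballP[e /= e0 fe].
pose M : R := m.+1%:R; have M0 : 0 < M by rewrite ltr0n.
have d0 : 0 < Num.min e (M^-1 / 2) by rewrite lt_min e0 divr_gt0// invr_gt0.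
have [g [r0 r00 [fg gd]]] := dense_almost_differentiable f cK puK KQ T1 d0.
have : closure (~` almost_differentiable K T m) g.
  have fge : lip1_dist f g < e by rewrite (lt_le_trans fg)// ge_min lexx.
  by apply: fe; rewrite ballEmdist.
pose r := Num.min r0 M^-1 / 2.
have m0 : 0 < Num.min r0 M^-1 by rewrite lt_min r00 invr_gt0.
have r_gt0 : 0 < r by rewrite divr_gt0.
have mr : r < Num.min r0 M^-1 by rewrite /r; lra.
have rM : 0 < r / M / 4 by rewrite !divr_gt0.
move=> /(_ _ (nbhsx_ballx g _ rM))[h [nh]]; rewrite ballEmdist/= => gh; apply: nh.
have {}gh (z : Q) : `|lip1_fun g z - lip1_fun h z| <= r / M / 4.
  by rewrite (le_trans (lip1_dist_ub _ _ _))// ltW.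
exists r; split; first by rewrite r_gt0 (lt_le_trans mr)// ge_min lexx orbT.
move=> x z Kx zr; have zr0 : `|val z - val x| < r0.
  by rewrite (le_lt_trans zr)// (lt_le_trans mr)// ge_min lexx.
have := gd x z Kx zr0; set v := val z - val x => gv.
have gv2 : `|lip1_fun g z - lip1_fun g x - T v| <= r / M / 2.
  rewrite (le_trans gv)// (@le_trans _ _ (M^-1 / 2 * r))//.
    by apply: ler_pM => //; [exact: ltW|rewrite ge_min lexx orbT].
  by rewrite le_eqVlt; apply/orP; left; apply/eqP; rewrite mulrC mulrA.
have -> : lip1_fun h z - lip1_fun h x - T v =
    (lip1_fun h z - lip1_fun g z) + (lip1_fun g z - lip1_fun g x - T v)
    + (lip1_fun g x - lip1_fun h x).
  by rewrite -!addrA addKr [- T v + (_ + _)]addrCA addKr [- T v + _]addrC.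
rewrite (le_trans (ler_normD _ _))// (le_trans (lerD (ler_normD _ _) (lexx _)))//.
have := gh z; rewrite distrC; have := gh x; rewrite -/M.
by move: gv2; set q := r / M; lra.
Qed.

(** The lower limit is nonnegative because [z = x] contributes 0 to each
    supremum. *)
Lemma derivative_set_approx (f : Q -> Y) (x : Q) (T : X -> Y) :
  bounded_operators T ->
  (forall e d : R, 0 < e -> 0 < d -> exists2 r, 0 < r < d &
    forall z : Q, `|val z - val x| <= r ->
      `|f z - f x - T (val z - val x)| <= e * r) ->
  derivative_set f x T.
Proof.
move=> bT H; split => //.
have [L LE _] := bounded_operatorsP bT.
rewrite limf_einfE; apply/eqP; rewrite eq_le; apply/andP; split.
  apply: ge_ereal_sup => _ [V V0 <-]; apply/lee_addgt0Pr => e e0.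
  have [d /= d0 dV] := V0.
  have [r /andP[r0 rd] Hr] := H e d e0 d0.
  rewrite add0e; apply: (@le_trans _ _ (ereal_sup
      [set (`|f z - f x - T (val z - val x)| / r)%:E | z in
        [set z : Q | `|val z - val x| <= r]])).
    apply: ereal_inf_lbound; exists r => //; apply: dV => //=.
    by rewrite sub0r normrN gtr0_norm.
  apply: ge_ereal_sup => _ [z /= zr <-].
  by rewrite lee_fin ler_pdivrMr//; exact: Hr.
apply: le_ereal_sup_tmp; eexists.
  by exists [set r : R | 0 < r]; [exact: nbhs_right_gt|reflexivity].
apply: le_ereal_inf_tmp => _ [r /= r0 <-]; apply: ereal_sup_ubound.
exists x => /=; first by rewrite subrr normr0 ltW.
by rewrite !subrr LE linear0 subrr normr0 mul0r.
Qed.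

End typical.

Theorem theorem1p2 (R : realType) (X : finNormedModType R)
    (Y : completeNormedModType R) (W : set (X -> Y)) (Q E : set X)
    (bQ : bounded_set Q) (subW : operator_subspace W)
    (sepW : opnorm_separable W) (EQ : E `<=` Q°) (FE : Fsigma E)
    (puE : purely_unrectifiable E) :
  residual [set f : lip1 Y bQ | forall x : Q, E (val x) ->
    op_unit_ball W `<=` derivative_set (lip1_fun f) x].
Proof.
have [K cK EK] := FE; have [S [S1 Sd]] := separable_op_unit_ball subW sepW.
have KE i : K i `<=` E by rewrite EK; exact: bigcup_sup.
have KQ i : K i `<=` Q° by apply: subset_trans EQ; exact: KE.
have puK i : purely_unrectifiable (K i) by exact: purely_unrectifiableS puE.
have cptK i : compact (K i).
  apply: closed_bounded_compact; last exact: cK.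
  have [M [Mr QM]] := bQ; exists M; split => // N MN x Kx; apply: QM => //.
  by apply: interior_subset; exact: KQ Kx.
pose code n : nat * nat * nat := odflt (0, 0, 0)%N (unpickle n).
pose good n := almost_differentiable (bQ := bQ)
  (K (code n).1.1) (S (code n).1.2) (code n).2.
set A := [set f | _].
exists (fun n => ~` A `&` ~` good n) => [n|].
  apply: (nowhere_denseS (@subIsetr _ _ _)).
  exact: nowhere_dense_not_almost_differentiable.
rewrite -setI_bigcupr -setC_bigcap; apply/esym/setIidPl; apply: subsetC.
move=> f fgood x; rewrite EK => -[i _ Kx] T WT.
have [Wb _ _] := subW; apply: derivative_set_approx; first by apply: Wb; case: WT.
move=> e d e0 d0.
have e20 : 0 < e / 2 by rewrite divr_gt0.
have [j Tj] := Sd T WT _ e20.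
have [m m_lt] : exists m : nat, m.+1%:R^-1 < Num.min d (e / 2).
  have : 0 < Num.min d (e / 2) by rewrite lt_min d0.
  by move=> /ltr_add_invr[m]; rewrite add0r => ?; exists m.
move: m_lt; rewrite lt_min => /andP[md me].
have : good (pickle (i, j, m)) f by exact: fgood.
rewrite /good /code pickleK/= => -[r [/andP[r0 rm] Hr]].
exists r; first by rewrite r0 (lt_trans rm).
move=> z zr; set v := val z - val x.
have -> : lip1_fun f z - lip1_fun f x - T v =
    (lip1_fun f z - lip1_fun f x - S j v) - (T v - S j v).
  by rewrite opprB addrA subrK.
rewrite (le_trans (ler_normB _ _))// [e]splitr mulrDl lerD//.
  by rewrite (le_trans (Hr x z Kx zr))// mulrC ler_wpM2r ?ltW.
by rewrite (le_trans (Tj v))// ler_wpM2l// ltW.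
Qed.
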